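(* Let $\bar r\in\mathbb{R}_+$, $\sigma\in(0,\bar r/2)$, and let $d_0\ge 5$ be an integer. Then there exist a state space $\mathcal{S}$, an action set $\mathcal{A}$, transition functions $(p_t)_{t\ge 0}$, reward functions $(R_t)_{t\ge0}$ with maximum per-slot reward $\bar r$ (and values in $[0,\bar r]$), and an initial distribution $\mu_0$ on $\mathcal{S}$ such that, for every even $T>2d_0+2$, the instance $\mathcal{I}_0=(R_{[T]},p_{[T]},T)$ has $0$-diameter $\tau_0(\mathcal{I}_0)=d_0$ and the regret of temporal concatenation satisfies $$\Delta(\mathcal{I}_0,\mu_0)=(\tau_0(\mathcal{I}_0)-2)\,\bar r-\sigma.$$
   Context: Notation: $[n]=\{0,1,\dots,n-1\}$; $\delta_{\rm TV}(\mu,\nu)=\frac12\sum_s|\mu(s)-\nu(s)|$. MDP instance. Fix a discrete (at most countable) state space $\mathcal{S}$ and action set $\mathcal{A}$. An instance $\mathcal{I}=(R_{[T]},p_{[T]},T)$ with horizon $T\in\mathbb{N}$ consists of transition functions $p_t$ and reward functions $R_t$, $t\in[T]$. The state evolves as $S_{t+1}=p_t(a_t,S_t,Y^S_t)$, $t\in[T]$, with $Y^S_t$ i.i.d. uniform on a finite set $\mathcal{Y}^S$, and $S_0\sim\mu_0$. The reward in slot $t$ is $R_t(a_t,S_t,Y^R_t)\in[0,\bar r]$, with $Y_t^R$ i.i.d. with a fixed distribution on a finite set $\mathcal{Y}^R$. A policy $\pi$ selects $a_t=\pi(t,S_t,Y^P)$ with $Y^P$ uniform on $[0,1]$. The variables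 $S_0,(Y^S_t)_t,(Y^R_t)_t,Y^P$ are independent. The total expected reward is $V(\mathcal{I},\pi,\mu_0)=\mathbb{E}^\pi_{S_0\sim\mu_0}\big[\sum_{t=0}^{T-1}R_t(a_t,S_t,Y^R_t)\big]$. A policy is optimal for $\mathcal{I}$ if it attains the maximum of $V(\mathcal{I},\cdot,\mu_0)$ for every $\mu_0$. Temporal concatenation ($T$ even). Let $\mathcal{I}_1$ be the horizon-$T/2$ instance with rewards and transitions $R_t,p_t$, $0\le t\le T/2-1$, and $\mathcal{I}_2$ the horizon-$T/2$ instance with rewards and transitions $R_{t},p_{t}$, $T/2\le t\le T-1$ (re-indexed to start at $0$). Let $\pi_1^*,\pi_2^*$ be optimal policies for $\mathcal{I}_1,\mathcal{I}_2$. The policy $\pi_{\rm TC}$ uses $\pi_1^*(t,S_t,Y^P_1)$ for $0\le t\le T/2-1$ and $\pi_2^*(t-T/2,S_t,Y^P_2)$ for $T/2\le t\le T-1$, where $Y_1^P,Y_2^P$ are independent uniform variables on $[0,1]$ obtained from $Y^P$ (odd and even binary digits). Regret. $\Delta(\mathcal{I}_0,\mu_0)=V(\mathcal{I}_0,\pi^*,\mu_0)-V(\mathcal{I}_0,\pi_{\rm TC},\mu_0)$, where $\pi^*$ is an optimal policy for $\mathcal{I}_0$. $0$-diameter. Let $\mathcal{P}$ be the set of probability distributions on $\mathcal{S}$. $\mathcal{P}^{t_0}_0(\mu,t)$ is the set of $\nu\in\mathcal{P}$ for which there is a policy $\pi$ such that, if the state at time $t_0$ has distribution $\mu$ and $\pi$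 is used, the distribution of $S_{t_0+t}$ equals $\nu$ (i.e. is at total variation distance $0$ from $\nu$). Then $$\tau_0(\mathcal{I})=\inf\{t\ge 0:\ \nu'\in\mathcal{P}_0^{t_0}(\nu,t)\text{ for all }\nu,\nu'\in\mathcal{P}\text{ and all }t_0\in[T-t]\},$$ with $t$ ranging over integers. *)

(* Defs.v *)
From HB Require Import structures.
From mathcomp Require Import all_boot all_order all_algebra.
From mathcomp Require Import all_classical all_reals all_analysis.

Set Implicit Arguments.
Unset Strict Implicit.
Unset Printing Implicit Defensive.

Import Order.TTheory GRing.Theory Num.Theory.
Import numFieldNormedType.Exports.

Local Open Scope classical_set_scope.
Local Open Scope ring_scope.

Definition is_pmf (R : realType) (X : choiceType) (mu : X -> R) : Prop :=
  (forall x, 0 <= mu x) /\ (\esum_(x in [set: X]) (mu x)%:E = 1)%E.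

(* Only the values [trans t], [reward t] with [t < horizon] are relevant.  The
   transition noise is uniform on YS; the reward noise has law [rlaw] on YR. *)
Record instance (R : realType) (S A : countType) (YS YR : finType) := Instance {
  horizon : nat;
  trans : nat -> A -> S -> YS -> S;
  reward : nat -> A -> S -> YR -> R;
  rlaw : YR -> R
}.

(* [r] takes its values in [0, rbar] and its maximum is rbar. *)
Definition max_reward (R : realType) (S A : countType) (YR : finType)
    (r : nat -> A -> S -> YR -> R) (rbar : R) : Prop :=
  (forall t a s y, 0 <= r t a s y <= rbar) /\ (exists t a s y, r t a s y = rbar).

(* The last argument is the value in [0, 1] of the variable randomizing the
   policy, drawn once and shared by all slots. *)
Definition policy (R : realType) (S A : countType) : Type := nat -> S -> R -> A.

(* A is discrete: u |-> pi t s u is measurable iff all its fibers are. *)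
Definition is_policy (R : realType) (S A : countType) (pi : policy R S A) : Prop :=
  forall t s a, measurable [set u : R | u \in `[0, 1] /\ pi t s u = a].

Section MDP.
Variables (R : realType) (S A : countType) (YS YR : finType).
Implicit Types (I : instance R S A YS YR) (pi : policy R S A) (mu nu : S -> R).

(* The state reached from state [s] at time [t] once the successive values [ys]
   of the transition noise have been consumed, the policy variable being [u]. *)
Fixpoint run I pi (u : R) (t : nat) (s : S) (ys : seq YS) : S :=
  if ys is y :: ys' then run I pi u t.+1 (trans I t (pi t s u) s y) ys' else s.

(* The state at time t0 + t (with t0 + t <= T) when the state at time t0 is s;
   the entry of index i of ys is the transition noise of slot i. *)
Definition state_from I pi (t0 t : nat) (s : S) (ys : (horizon I).-tuple YS)
    (u : R) : S :=
  run I pi u t0 s (take t (drop t0 ys)).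

(* Expectation of X(S, Y^S, Y^R, U) for independent S ~ mu, Y^S uniform on
   YS^T, Y^R with law rlaw^T and U uniform on [0, 1], for X >= 0. *)
Definition expect I mu
    (X : S -> (horizon I).-tuple YS -> (horizon I).-tuple YR -> R -> R) : \bar R :=
  (\esum_(s in [set: S]) ((mu s)%:E *
     \int[lebesgue_measure]_(u in `[0%R, 1%R])
       (\sum_(ys : (horizon I).-tuple YS) \sum_(yr : (horizon I).-tuple YR)
          (#|YS|%:R^-1 ^+ horizon I * \prod_(t < horizon I) rlaw I (tnth yr t))
          * X s ys yr u)%R%:E))%E.

Definition total_reward I pi (s : S) (ys : (horizon I).-tuple YS)
    (yr : (horizon I).-tuple YR) (u : R) : R :=
  \sum_(t < horizon I)
     let st := state_from pi 0 t s ys u in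
     reward I t (pi t st u) st (tnth yr t).

Definition value I pi mu : \bar R := expect mu (@total_reward I pi).

Definition optimal I pi : Prop :=
  is_policy pi /\
  forall mu, is_pmf mu -> forall pi', is_policy pi' ->
    (value I pi' mu <= value I pi mu)%E.

Definition first_half I : instance R S A YS YR :=
  Instance (horizon I)./2 (trans I) (reward I) (rlaw I).

Definition second_half I : instance R S A YS YR :=
  Instance (horizon I)./2 (fun t => trans I ((horizon I)./2 + t))
    (fun t => reward I ((horizon I)./2 + t)) (rlaw I).

(* The k-th binary digit (k >= 1) of u in [0, 1[; every digit of u = 1 is
   read as 0, which only concerns a null set. *)
Definition binary_digit (u : R) (k : nat) : bool := odd (Num.truncn (u * 2 ^+ k)).

Definition odd_digits (u : R) : R :=
  limn (series (fun k => (binary_digit u k.*2.+1)%:R * 2^-1 ^+ k.+1 : R)).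

Definition even_digits (u : R) : R :=
  limn (series (fun k => (binary_digit u k.*2.+2)%:R * 2^-1 ^+ k.+1 : R)).

Definition temporal_concat I (pi1 pi2 : policy R S A) : policy R S A :=
  fun t s u =>
    if (t < (horizon I)./2)%N then pi1 t s (odd_digits u)
    else pi2 (t - (horizon I)./2)%N s (even_digits u).

(* pistar, pi1, pi2 : optimal policies for I and for its two halves *)
Definition regret I (pistar pi1 pi2 : policy R S A) mu : \bar R :=
  (value I pistar mu - value I (temporal_concat I pi1 pi2) mu)%E.

Definition state_law I pi (t0 t : nat) mu (s' : S) : \bar R :=
  expect mu (fun s (ys : (horizon I).-tuple YS) _ u =>
    (state_from pi t0 t s ys u == s')%:R).

Definition reach0 I (t0 : nat) mu (t : nat) : set (S -> R) :=
  [set nu | is_pmf nu /\ exists pi, is_policy pi /\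
     forall s', state_law I pi t0 t mu s' = (nu s')%:E].

Definition diameter0 I : R :=
  inf [set (t%:R : R) | t in [set t : nat |
    forall nu nu', is_pmf nu -> is_pmf nu' ->
    forall t0, (t0 < horizon I - t)%N -> reach0 I t0 nu t nu']].

End MDP.

(* Main.v *)
(* The instance is deterministic and stationary, on the states 0, ..., d with
   d + 1 = d0. At the hub 0 the controller may stay (reward c), jump to state 1
   (reward rbar) or jump to any other state (reward 0); every state s <> 0 moves
   to s + 1 mod d0 without reward. From 1 one needs d steps to come back to the
   hub, whence diameter d0. Starting from the hub, the only optimal behaviour is
   to stay until the last slot and then to jump to 1. Hence temporal
   concatenation earns rbar instead of c in the last slot of the first half but
   then starts the second half in state 1, losing d slots of reward c: the regret
   is d * c - (rbar - c), which equals (d0 - 2) * rbar - sigma for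
   c = ((d0 - 1) * rbar - sigma) / d0.
   An optimal randomized policy may misbehave on a null set of values of its
   randomizing variable, so one also needs that extracting the odd or the even
   binary digits pulls null sets back to null sets. *)
Require Import Defs.
From mathcomp Require Import all_boot all_order all_algebra.
From mathcomp Require Import all_classical all_reals all_analysis measurable_realfun.
From mathcomp Require Import zify ring lra.

Set Implicit Arguments.
Unset Strict Implicit.
Unset Printing Implicit Defensive.

Import Order.TTheory GRing.Theory Num.Theory.
Import numFieldNormedType.Exports.

Local Open Scope classical_set_scope.
Local Open Scope ring_scope.

(** * Subsequences of binary digits *)

(** Both parities at once: the boolean, read as 0 or 1, shifts the digit index, so [false] extracts
    the odd digits and [true] the even ones. *)
Definition sub_digits (R : realType) (b : bool) (u : R) : R :=
  limn (series (fun k => (binary_digit u (b + k.*2.+1))%:R * 2^-1 ^+ k.+1 : R)).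

Lemma odd_digitsE (R : realType) : @odd_digits R = sub_digits false.
Proof. by []. Qed.

Lemma even_digitsE (R : realType) : @even_digits R = sub_digits true.
Proof. by []. Qed.

(* The n-th partial sum of [sub_digits b u], multiplied by 2 ^ n. *)
Fixpoint digits_code (R : realType) (b : bool) (u : R) (n : nat) : nat :=
  if n is n'.+1 then
    (2 * digits_code b u n' + binary_digit u (b + n'.*2.+1))%N
  else 0%N.

Lemma series_sub_digits (R : realType) (b : bool) (u : R) n :
  series (fun k => (binary_digit u (b + k.*2.+1))%:R * 2^-1 ^+ k.+1 : R) n
  = (digits_code b u n)%:R * 2^-1 ^+ n.
Proof.
elim: n => [|n IH]; first by rewrite /series /= big_geq// mul0r.
rewrite seriesSr IH /= natrD natrM exprS.
by field.
Qed.

(** The digit added at rank [n] weighs at most [h ^ n.+1 = h ^ n - h ^ n.+1], so the upper bounds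
    telescope. *)
Lemma digits_code_bound (R : realType) (b : bool) (u : R) m n : (m <= n)%N ->
  let h := 2^-1 : R in
  (digits_code b u m)%:R * h ^+ m <= (digits_code b u n)%:R * h ^+ n
    <= (digits_code b u m)%:R * h ^+ m + h ^+ m - h ^+ n.
Proof.
elim: n => [|n IH]; first by rewrite leqn0 => /eqP -> /=; lra.
rewrite leq_eqVlt => /orP[/eqP -> /=|]; first by lra.
rewrite ltnS => /IH /=; rewrite natrD natrM exprS.
have : 0 <= 2^-1 ^+ n :> R by rewrite exprn_ge0.
move: (2^-1 ^+ n) => e e0; case: binary_digit => /=; lra.
Qed.

Lemma cvg_sub_digits (R : realType) (b : bool) (u : R) :
  (digits_code b u n)%:R * 2^-1 ^+ n @[n --> \oo] --> sub_digits b u.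
Proof.
rewrite /sub_digits (_ : series _ =
  (fun n => (digits_code b u n)%:R * 2^-1 ^+ n)); last first.
  by apply/funext => n; rewrite series_sub_digits.
apply: nondecreasing_is_cvgn.
  by move=> m n mn; case/andP: (digits_code_bound b u mn).
exists 1 => _ [n _ <-].
have /andP[_] := digits_code_bound b u (leq0n n).
have : 0 <= 2^-1 ^+ n :> R by rewrite exprn_ge0.
by rewrite /= mul0r expr0; lra.
Qed.

(** Limit of the previous bounds: the code locates [sub_digits b u] in a dyadic cell, closed on the
    right because all later digits may be 1. *)
Lemma sub_digits_bound (R : realType) (b : bool) (u : R) n :
  let h := 2^-1 : R in
  (digits_code b u n)%:R * h ^+ n <= sub_digits b u
    <= ((digits_code b u n)%:R + 1) * h ^+ n.
Proof.
have cv := @cvg_sub_digits R b u.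
rewrite /= -(cvg_lim (@Rhausdorff R) cv); apply/andP; split.
- apply: limr_ge; first by apply/cvg_ex; exists (sub_digits b u).
  by exists n => // m /= nm; case/andP: (digits_code_bound b u nm).
- apply: limr_le; first by apply/cvg_ex; exists (sub_digits b u).
  exists n => // m /= nm; case/andP: (digits_code_bound b u nm) => _.
  have : 0 <= 2^-1 ^+ m :> R by rewrite exprn_ge0.
  by lra.
Qed.

Lemma sub_digits_itv (R : realType) (b : bool) (u : R) :
  sub_digits b u \in `[0, 1].
Proof. by have := sub_digits_bound b u 0; rewrite in_itv /= expr0; lra. Qed.

Lemma measurable_truncn_preimage (R : realType) (P : pred nat) (c : R) :
  measurable [set u : R | P (Num.truncn (u * c))].
Proof.
have mtr n : measurable [set x : R | Num.truncn x = n].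
  (* [truncn] sends negative reals to 0, whence the unbounded fiber over 0. *)
  rewrite (_ : [set x | _] = if n is 0%N then `]-oo, 1[%classic
                             else `[n%:R, n.+1%:R[%classic).
    by case: n => [|n]; exact: measurable_itv.
  apply/seteqP; case: n => [|n]; split=> x /=; rewrite in_itv/=.
  - by move=> x0; rewrite ltNge -truncn_gt0 x0.
  - by rewrite ltNge -truncn_gt0; case: Num.truncn.
  - move=> xn; have x0 : 0 <= x.
      have : (0 < Num.truncn x)%N by rewrite xn.
      by rewrite truncn_gt0; lra.
    by rewrite -xn truncn_itv.
  - exact: truncn_def.
have mfc : measurable_fun setT (fun u : R => u * c).
  by apply: measurable_funM => //; exact: measurable_cst.
rewrite (_ : [set u | _] = setT `&` (fun u : R => u * c) @^-1`
  (\bigcup_(n in [set n | P n]) [set x : R | Num.truncn x = n])).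
  apply: mfc => //; apply: bigcup_measurable => n _; exact: mtr.
by apply/seteqP; split=> u /=; [move=> Pu; split=> //; exists (Num.truncn (u * c))
  | case=> _ [n /= Pn ->]].
Qed.

Lemma measurable_digits_code (R : realType) (b : bool) n :
  measurable_fun setT (fun u : R => (digits_code b u n)%:R : R).
Proof.
elim: n => [|n IH] /=; first exact: measurable_cst.
rewrite (_ : (fun u => _) = (fun u => 2 * (digits_code b u n)%:R +
   \1_[set u : R | binary_digit u (b + n.*2.+1)] u)).
  apply: measurable_funD.
    by apply: measurable_funM => //; exact: measurable_cst.
  by apply: measurable_indic; exact: (measurable_truncn_preimage odd).
apply/funext => u; rewrite natrD natrM indicE; congr (_ + _%:R).
by congr nat_of_bool; apply/idP/idP; rewrite inE.
Qed.

Lemma measurable_sub_digits (R : realType) (b : bool) :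
  measurable_fun setT (@sub_digits R b).
Proof.
apply: (@measurable_fun_cvg _ _ _ _
  (fun n u => (digits_code b u n)%:R * 2^-1 ^+ n)).
- move=> n; apply: measurable_funM; last exact: measurable_cst.
  exact: measurable_digits_code.
- by move=> u _; exact: cvg_sub_digits.
Qed.

(** Integer division recovers the coarse digits of a number from the integer part of a finer
    multiple of it. *)
Lemma truncn_divn (R : realType) (x : R) (d : nat) : 0 <= x -> (0 < d)%N ->
  (Num.truncn (x * d%:R) %/ d)%N = Num.truncn x.
Proof.
move=> x0 d0; apply/eqP; rewrite eqn_leq; apply/andP; split.
- rewrite truncn_ge_nat// -(@ler_pM2r _ d%:R) ?ltr0n//.
  rewrite -natrM (le_trans _ (_ : (Num.truncn (x * d%:R))%:R <= _))//.
    by rewrite ler_nat leq_divM.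
  by rewrite truncn_le mulr_ge0.
- rewrite leq_divRL// truncn_ge_nat ?mulr_ge0// natrM ler_wpM2r//.
  by rewrite truncn_le.
Qed.

(* [digits_code b u n] read off the integer part [m] of [4 ^ n * u], each base 4
   digit of which contributes one binary digit. *)
Fixpoint quad_code (b : bool) (m n : nat) : nat :=
  if n is n'.+1 then (2 * quad_code b (m %/ 4) n' + odd (m %/ 2 ^ ~~ b))%N
  else 0%N.

Lemma digits_codeE (R : realType) (b : bool) (u : R) n : 0 <= u ->
  digits_code b u n = quad_code b (Num.truncn (u * (4 ^ n)%:R)) n.
Proof.
move=> u0; elim: n => [//|n IH] /=.
have -> : (Num.truncn (u * (4 ^ n.+1)%:R) %/ 4)%N = Num.truncn (u * (4 ^ n)%:R).
  by rewrite expnSr natrM mulrA truncn_divn// mulr_ge0.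
rewrite -IH.
congr (2 * _ + nat_of_bool _)%N; rewrite /binary_digit; congr odd.
(* The last base 4 digit holds two bits; the even-ranked one is its low bit, the odd-ranked one its
   high bit, reached by one more halving. *)
rewrite (_ : (4 ^ n.+1)%:R = 2 ^+ (b + n.*2.+1) * (2 ^ ~~ b)%:R :> R).
  by rewrite mulrA truncn_divn// ?expn_gt0// mulr_ge0// exprn_ge0.
rewrite -natrX -natrM -expnD (_ : 4%N = 2 ^ 2)%N// -expnM.
by congr (2 ^ _)%:R; case: b {IH}; rewrite /=; lia.
Qed.

(** A prescribed bit leaves two of the four values of each base 4 digit: the last digit of [m] must
    match [odd j], and [m %/ 4] must have code [j./2]. *)
Lemma count_quad_code (b : bool) (n j : nat) :
  (\sum_(0 <= m < 4 ^ n) (quad_code b m n == j) <= 2 ^ n)%N.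
Proof.
elim: n j => [|n IH] j; first by rewrite expn0 big_nat1 leq_b1.
rewrite !expnS mulnC big_nat_mul /=.
apply: (@leq_trans (\sum_(0 <= i < 4 ^ n) 2 * (quad_code b i n == j./2))%N).
  apply: leq_sum => i _.
  rewrite mulSn -{1}[(i * 4)%N]add0n big_addn addnK.
  rewrite !big_nat_recl// big_geq// add0n !addSn add0n addn0.
  have -> : ((i * 4) %/ 4 = i)%N by lia.
  have -> : ((i * 4).+1 %/ 4 = i)%N by lia.
  have -> : ((i * 4).+2 %/ 4 = i)%N by lia.
  have -> : ((i * 4).+3 %/ 4 = i)%N by lia.
  have step (c : bool) : ((2 * quad_code b i n + c == j) =
      (c == odd j) && (quad_code b i n == j./2))%N.
    by case: c; apply/idP/idP; lia.
  have half4 k : ((i * 4 + k) %/ 2 = i * 2 + k %/ 2)%N by lia.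
  have oddq k : odd ((i * 4 + k) %/ 2 ^ ~~ b) = odd (k %/ 2 ^ ~~ b).
    by case: b {IH step}; rewrite ?divn1 ?half4 oddD oddM ?andbF.
  rewrite -[(i * 4)%N]addn0 -!addnS !oddq !step.
  by case: b {IH step oddq}; case: (odd j) => /=; case: eqP.
by rewrite -big_distrr /= leq_mul2l IH.
Qed.

Lemma measurable_digits_code_eq (R : realType) (b : bool) (n j : nat) :
  measurable [set u : R | 0 <= u < 1 /\ digits_code b u n = j].
Proof.
rewrite (_ : [set u | _] = [set` `[0, 1[] `&` (setT `&`
   (fun u : R => (digits_code b u n)%:R : R) @^-1` [set j%:R])).
  by apply: measurableI => //; exact: measurable_digits_code.
apply/seteqP; split=> u /=; rewrite in_itv /=; first by case=> -> ->.
by case=> -> [_ /eqP]; rewrite eqr_nat => /eqP.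
Qed.

(** The set is covered by the cells of length [4 ^- n] whose index has code [j]; there are at most
    [2 ^ n] of them. *)
Lemma measure_digits_code (R : realType) (b : bool) (n j : nat) :
  (lebesgue_measure [set u : R | (0 <= u < 1)%R /\ digits_code b u n = j]
   <= (2^-1 ^+ n)%:E)%E.
Proof.
pose F m : set R := if quad_code b m n == j
  then `[m%:R / (4 ^ n)%:R, m.+1%:R / (4 ^ n)%:R[%classic else set0.
have p4 : 0 < (4 ^ n)%:R :> R by rewrite ltr0n expn_gt0.
have muF m : lebesgue_measure (F m)
    = ((quad_code b m n == j)%:R / (4 ^ n)%:R)%:E.
  rewrite /F; case: eqP => _; last by rewrite measure0 mul0r.
  rewrite lebesgue_measure_itv /= lte_fin ltr_pM2r ?invr_gt0// ltr_nat ltnSn.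
  by rewrite -EFinB -mulrBl -natrB// subSnn.
have mF m : measurable (F m) by rewrite /F; case: ifP.
have sub : [set u : R | (0 <= u < 1)%R /\ digits_code b u n = j]
    `<=` \big[setU/set0]_(m < 4 ^ n) F m.
  move=> u [] /andP[u0 u1] uj.
  rewrite -bigcup_mkord; exists (Num.truncn (u * (4 ^ n)%:R)) => /=.
    by rewrite truncn_lt_nat ?mulr_ge0// gtr_pMl.
  rewrite /F -digits_codeE// uj eqxx /= in_itv /= ler_pdivrMr// ltr_pdivlMr//.
  by rewrite truncn_itv// mulr_ge0.
have mE := @measurable_digits_code_eq R b n j.
apply: (le_trans (content_subadditive lebesgue_measure (fun m _ => mF m) mE sub)).
rewrite (eq_bigr (fun m : 'I__ => ((quad_code b m n == j)%:R / (4 ^ n)%:R)%:E)).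
  2: by move=> m _; exact: muF.
rewrite sumEFin -big_distrl /= lee_fin ler_pdivrMr//.
rewrite -natr_sum -(big_mkord xpredT (fun m => (quad_code b m n == j) : nat)).
apply: le_trans (_ : (2 ^ n)%:R <= _); first by rewrite ler_nat count_quad_code.
by rewrite (_ : 4%N = (2 * 2)%N)// expnMn natrM natrX exprVn mulrA mulVf ?mul1r//.
Qed.

(** At a scale [e = 2 ^- n <= y - x], at most [(y - x) / e + 3] codes are possible and each has
    measure at most [e], so the total is at most [y - x + 3 * e]. *)
Lemma measure_sub_digits_itv (R : realType) (b : bool) (x y : R) : x < y ->
  (lebesgue_measure [set u : R | (0 <= u < 1)%R /\ (x < sub_digits b u <= y)%R]
   <= (4 * (y - x))%:E)%E.
Proof.
move=> xy; have yx0 : 0 < y - x by rewrite subr_gt0.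
have [n hn] : exists n, (2^-1 : R) ^+ n <= y - x.
  exists (Num.truncn (y - x)^-1); rewrite exprVn -[leRHS]invrK lef_pV2 ?posrE ?invr_gt0 ?exprn_gt0//.
  apply: ltW; apply: lt_le_trans (truncnS_gt _) _.
  by rewrite -natrX ler_nat ltn_expl.
pose e := (2^-1 : R) ^+ n; have e0 : 0 < e by rewrite exprn_gt0.
pose k0 := Num.truncn (x / e - 1).
(* Possible codes lie between [x / e - 1] and [y / e]; the 3 absorbs this shift by 1 and the two
   truncations. *)
pose K := (Num.truncn ((y - x) / e) + 3)%N.
pose F i := [set u : R | 0 <= u < 1 /\ digits_code b u n = (k0 + i)%N].
have sub : [set u : R | 0 <= u < 1 /\ x < sub_digits b u <= y]
    `<=` \big[setU/set0]_(i < K) F i.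
  move=> u [u01 /andP[xu uy]]; rewrite -bigcup_mkord.
  have /andP := sub_digits_bound b u n; rewrite -/e => -[lu ul].
  have lx : x / e - 1 < (digits_code b u n)%:R.
    rewrite ltrBlDr ltr_pdivrMr//; exact: lt_le_trans ul.
  have ly : (digits_code b u n)%:R <= y / e.
    by rewrite ler_pdivlMr//; exact: le_trans uy.
  have k0d : (k0 <= digits_code b u n)%N.
    have [k00|k0p] := leqP k0 0%N; first by rewrite (leq_trans k00).
    rewrite -(ler_nat R) ltW// (le_lt_trans _ lx)//.
    by rewrite truncn_le; move: k0p; rewrite /k0 truncn_gt0; lra.
  exists (digits_code b u n - k0)%N; rewrite /F /=; last by rewrite subnKC.
  rewrite ltn_subLR// -(ltr_nat R) /K addnA !natrD.
  have t1 := truncnS_gt (x / e - 1); rewrite -/k0 in t1.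
  have t2 := truncnS_gt ((y - x) / e).
  move: t1 t2; rewrite -!natr1 mulrBl; lra.
have mE : measurable [set u : R | 0 <= u < 1 /\ x < sub_digits b u <= y].
  rewrite (_ : [set u | _] = [set` `[0, 1[] `&` (setT `&`
     sub_digits b @^-1` [set` `]x, y]])).
    by apply: measurableI => //; exact: measurable_sub_digits.
  apply/seteqP; split=> u /=; rewrite !in_itv /=; first by case=> -> ->.
  by case=> -> [].
have mF i : measurable (F i) by exact: measurable_digits_code_eq.
apply: (le_trans (content_subadditive lebesgue_measure (fun m _ => mF m) mE sub)).
apply: (@le_trans _ _ (\sum_(i < K) e%:E)%E).
  by apply: lee_sum => i _; exact: measure_digits_code.
rewrite sumEFin sumr_const card_ord lee_fin -[e *+ K]mulr_natl /K natrD.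
have : (Num.truncn ((y - x) / e))%:R <= (y - x) / e.
  by rewrite truncn_le divr_ge0// ltW.
rewrite ler_pdivlMr// mulrDl; move: hn; rewrite -/e; lra.
Qed.

(* The law of a digit subsequence of a uniform variable is at most 4 times
   Lebesgue measure on half-open intervals, so a cover of [N] of small length
   pulls back to a cover of small measure. *)
Lemma sub_digits_negligible (R : realType) (b : bool) (N : set R) :
  lebesgue_measure.-negligible N ->
  lebesgue_measure.-negligible [set u : R | u \in `[0, 1] /\ N (sub_digits b u)].
Proof.
move=> [M [mM M0 NM]].
have mpre (A : set R) : measurable A ->
    measurable [set u : R | 0 <= u < 1 /\ A (sub_digits b u)].
  move=> mA; rewrite (_ : [set u | _] = [set` `[0, 1[] `&` (setT `&`
     sub_digits b @^-1` A)).
    by apply: measurableI => //; exact: measurable_sub_digits.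
  apply/seteqP; split=> u /=; rewrite !in_itv /=; first by case=> -> ?.
  by case=> -> [].
(* The interval estimate concerns [[0, 1[]; the endpoint 1 is put back as a null singleton. *)
suff H : lebesgue_measure [set u : R | 0 <= u < 1 /\ M (sub_digits b u)] = 0%E.
  have neg : lebesgue_measure.-negligible
      ([set u : R | 0 <= u < 1 /\ M (sub_digits b u)] `|` [set 1]).
    apply: negligibleU; first by apply/negligibleP => //; exact: mpre.
    by apply/negligibleP => //; exact: lebesgue_measure_set1.
  apply: negligibleS neg => u [] /=; rewrite in_itv /= => /andP[u0 u1] /NM Mu.
  have [->|un1] := eqVneq u 1; [by right | left]; split=> //.
  by rewrite u0 lt_neqAle un1.
apply/eqP; rewrite eq_le measure_ge0 andbT.
apply/lee_addgt0Pr => e e0; rewrite add0e.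
have : (lebesgue_measure M < (e / 4)%:E)%E by rewrite M0 lte_fin divr_gt0.
move=> /ereal_inf_lt[z [/= F [mF MF] sMz zDe]].
have mFk k : measurable (F k : set R) by apply: sub_sigma_algebra; exact: mF.
apply: (@le_trans _ _ (\sum_(k <oo) lebesgue_measure
    [set u : R | (0 <= u < 1)%R /\ F k (sub_digits b u)])%E).
  apply: measure_sigma_subadditive => //; last first.
  - by move=> u [u01 /MF[k _ Fk]]; exists k.
  - exact: mpre.
  - by move=> k; apply: mpre.
apply: (@le_trans _ _ (\sum_(k <oo) (4%:E * wlength idfun (F k)))%E).
  apply: lee_nneseries => // k _.
  have /ocitvP[->|[[x y /= xy ->]]] := mF k.
    rewrite wlength0 mule0 (_ : [set u | _] = set0) ?measure0//.
    by apply/seteqP; split=> u // -[].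
  rewrite wlength_itv /= lte_fin xy -EFinB -EFinM.
  apply: le_trans (measure_sub_digits_itv b xy); rewrite le_measure ?inE//.
  - exact: (mpre `]x, y]%classic).
  - exact: (mpre `]x, y]%classic).
rewrite nneseriesZl//.
rewrite sMz (le_trans (lee_wpmul2l _ (ltW zDe)))// -EFinM lee_fin.
by rewrite mulrC divfK.
Qed.

(** * Deterministic decision processes *)

Fixpoint traj (R : realType) (S A : finType) (step : A -> S -> S)
    (pi : policy R S A) (u : R) (t : nat) (s : S) (n : nat) : S :=
  if n is n'.+1 then traj step pi u t.+1 (step (pi t s u) s) n' else s.

Fixpoint gain (R : realType) (S A : finType) (step : A -> S -> S)
    (rew : A -> S -> R) (pi : policy R S A) (u : R) (t : nat) (s : S) (n : nat) : R :=
  if n is n'.+1 then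
    rew (pi t s u) s + gain step rew pi u t.+1 (step (pi t s u) s) n'
  else 0.

Definition det_instance (R : realType) (S A : finType) (step : A -> S -> S)
    (rew : A -> S -> R) (T : nat) : instance R S A unit unit :=
  Instance T (fun _ a s _ => step a s) (fun _ a s _ => rew a s) (fun _ => 1).

Lemma trajD (R : realType) (S A : finType) (step : A -> S -> S)
    (pi : policy R S A) (u : R) t s m n :
  traj step pi u t s (m + n) = traj step pi u (t + m) (traj step pi u t s m) n.
Proof. by elim: m t s => [|m IH] t s; rewrite ?addn0// addSn /= IH addSnnS. Qed.

Lemma gainD (R : realType) (S A : finType) (step : A -> S -> S)
    (rew : A -> S -> R) (pi : policy R S A) (u : R) t s m n :
  gain step rew pi u t s (m + n) =
  gain step rew pi u t s m + gain step rew pi u (t + m) (traj step pi u t s m) n.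
Proof.
elim: m t s => [|m IH] t s; first by rewrite addn0 add0r.
by rewrite addSn /= IH addSnnS addrA.
Qed.

Lemma gain_sum (R : realType) (S A : finType) (step : A -> S -> S)
    (rew : A -> S -> R) (pi : policy R S A) (u : R) t s n :
  gain step rew pi u t s n = \sum_(k < n)
    rew (pi (t + k)%N (traj step pi u t s k) u) (traj step pi u t s k).
Proof.
elim: n t s => [|n IH] t s; first by rewrite big_ord0.
rewrite big_ord_recl /= addn0 IH; congr (_ + _); apply: eq_bigr => k _.
by rewrite /bump /= add1n addnS.
Qed.

(** Time origin and randomizing value may both differ: this compares the concatenated policy on each
    half with the policy of that half, run from time 0 on its own digits. *)
Lemma eq_traj_gain (R : realType) (S A : finType) (step : A -> S -> S)
    (rew : A -> S -> R) (pi pi' : policy R S A) (u u' : R) t t' s n :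
  (forall k x, (k < n)%N -> pi (t + k)%N x u = pi' (t' + k)%N x u') ->
  traj step pi u t s n = traj step pi' u' t' s n /\
  gain step rew pi u t s n = gain step rew pi' u' t' s n.
Proof.
elim: n t t' s => [//|n IH] t t' s E /=.
have := E 0%N s isT; rewrite !addn0 => ->.
have [|-> ->//] := IH t.+1 t'.+1 (step (pi' t' s u') s).
by move=> k x kn; rewrite !addSnnS E.
Qed.

Lemma run_traj (R : realType) (S A : finType) (step : A -> S -> S)
    (rew : A -> S -> R) T (pi : policy R S A) u t s (ys : seq unit) :
  run (det_instance step rew T) pi u t s ys = traj step pi u t s (size ys).
Proof. by elim: ys t s => [//|y ys IH] t s /=; rewrite IH. Qed.

Lemma state_from_traj (R : realType) (S A : finType) (step : A -> S -> S)
    (rew : A -> S -> R) T (pi : policy R S A) t0 t s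
    (ys : T.-tuple unit) (u : R) : (t0 + t <= T)%N ->
  state_from (I := det_instance step rew T) pi t0 t s ys u
  = traj step pi u t0 s t.
Proof.
move=> tT; rewrite /state_from run_traj size_takel// size_drop size_tuple.
rewrite /det_instance /=; lia.
Qed.

Lemma total_reward_gain (R : realType) (S A : finType) (step : A -> S -> S)
    (rew : A -> S -> R) T (pi : policy R S A) s (ys yr : T.-tuple unit) (u : R) :
  total_reward (I := det_instance step rew T) pi s ys yr u
  = gain step rew pi u 0 s T.
Proof.
rewrite gain_sum; apply: eq_bigr => k _ /=.
by rewrite state_from_traj// add0n ltnW.
Qed.

Lemma esum_finType (R : realType) (X : finType) (a : X -> \bar R) :
  (forall x, 0 <= a x)%E -> (\esum_(x in [set: X]) a x = \sum_(x : X) a x)%E.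
Proof.
move=> a0; rewrite (esum_fset (finite_finset : finite_set [set: X]) (fun x _ => a0 x)).
have <- : [set` index_enum X] = [set: X].
  by apply/seteqP; split=> x //= _; exact: mem_index_enum.
by rewrite -fsbig_seq// index_enum_uniq.
Qed.

(** With one-point noise each sum over noise tuples has a single term, of weight 1; only the initial
    state and the policy variable stay random. *)
Lemma expect_det (R : realType) (S A : finType) (step : A -> S -> S)
    (rew : A -> S -> R) T (mu : S -> R)
    (X : S -> T.-tuple unit -> T.-tuple unit -> R -> R) (Z : S -> R -> R) :
  (forall s, 0 <= mu s) -> (forall s u, 0 <= Z s u) ->
  (forall s ys yr u, X s ys yr u = Z s u) ->
  expect (I := det_instance step rew T) mu X =
  (\sum_(s : S) (mu s)%:E *
     \int[lebesgue_measure]_(u in `[0%R, 1%R]) (Z s u)%:E)%E.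
Proof.
move=> mu0 Z0 XZ; rewrite /expect.
have unitE (x y : unit) : x = y by case: x; case: y.
have tupE (F : T.-tuple unit -> R) : \sum_ys F ys = F (nseq_tuple T tt).
  rewrite (big_pred1 (nseq_tuple T tt))// => ys /=; apply/esym/eqP.
  by apply: eq_from_tnth => i; exact: unitE.
have -> : (fun s => (mu s)%:E * \int[lebesgue_measure]_(u in `[0%R, 1%R])
   (\sum_(ys : T.-tuple unit) \sum_(yr : T.-tuple unit)
      (#|{: unit}|%:R^-1 ^+ T * \prod_(t < T) 1) * X s ys yr u)%R%:E)%E =
   (fun s => (mu s)%:E * \int[lebesgue_measure]_(u in `[0%R, 1%R]) (Z s u)%:E)%E.
  apply/funext => s; congr (_ * _)%E; apply: eq_integral => u _.
  by rewrite !tupE XZ card_unit invr1 expr1n big1// mulr1 mul1r.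
rewrite esum_finType// => s.
by rewrite mule_ge0 ?lee_fin// integral_ge0// => u _; rewrite lee_fin.
Qed.

Lemma value_det (R : realType) (S A : finType) (step : A -> S -> S)
    (rew : A -> S -> R) T (pi : policy R S A) (mu : S -> R) :
  (forall s, 0 <= mu s) -> (forall a s, 0 <= rew a s) ->
  value (det_instance step rew T) pi mu =
  (\sum_(s : S) (mu s)%:E * \int[lebesgue_measure]_(u in `[0%R, 1%R])
     (gain step rew pi u 0 s T)%:E)%E.
Proof.
move=> mu0 rew0; apply: expect_det => // [s u|s ys yr u].
  by rewrite gain_sum sumr_ge0.
exact: total_reward_gain.
Qed.

Lemma state_law_det (R : realType) (S A : finType) (step : A -> S -> S)
    (rew : A -> S -> R) T (pi : policy R S A) t0 t (mu : S -> R) s' :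
  (forall s, 0 <= mu s) -> (t0 + t <= T)%N ->
  state_law (det_instance step rew T) pi t0 t mu s' =
  (\sum_(s : S) (mu s)%:E * \int[lebesgue_measure]_(u in `[0%R, 1%R])
     (traj step pi u t0 s t == s')%:R%:E)%E.
Proof.
move=> mu0 tT.
apply: (@expect_det _ _ _ _ _ _ _ _ (fun s u => (traj step pi u t0 s t == s')%:R)).
- exact: mu0.
- by move=> s u; rewrite ler0n.
- by move=> s ys _ u; rewrite state_from_traj.
Qed.

(** On [[0, 1]] the function is a finite sum over actions of [G a] times the indicator of a fiber of
    the policy. *)
Lemma measurable_policy_comp (R : realType) (S A : finType) (pi : policy R S A)
    (G : A -> R -> R) t s : is_policy pi ->
  (forall a, measurable_fun (`[0, 1]%classic : set R) (G a)) ->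
  measurable_fun (`[0, 1]%classic : set R) (fun u => G (pi t s u) u).
Proof.
move=> mpi mG.
apply: (eq_measurable_fun (fun u => \sum_a
   \1_[set v | v \in `[0, 1] /\ pi t s v = a] u * G a u)).
  move=> u; rewrite inE /= => u01; rewrite (bigD1 (pi t s u))//= big1 ?addr0.
    by rewrite indicE mem_set ?mul1r.
  by move=> a /eqP na; rewrite indicE memNset ?mul0r// => -[_ /esym].
by apply: measurable_sum => a; exact: measurable_funM.
Qed.

Lemma measurable_gain (R : realType) (S A : finType) (step : A -> S -> S)
    (rew : A -> S -> R) (pi : policy R S A) t s n : is_policy pi ->
  measurable_fun (`[0, 1]%classic : set R) (fun u => gain step rew pi u t s n).
Proof.
move=> mpi; elim: n t s => [|n IH] t s /=; first exact: measurable_cst.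
apply: (@measurable_policy_comp _ _ _ _
  (fun a u => rew a s + gain step rew pi u t.+1 (step a s) n)) => // a.
by apply: measurable_funD; [exact: measurable_cst | exact: IH].
Qed.

(** A supersolution of the Bellman equation dominates gains pathwise, for each fixed [u]. *)
Lemma gain_le_bellman (R : realType) (S A : finType) (step : A -> S -> S)
    (rew : A -> S -> R) (V : nat -> S -> R) (pi : policy R S A) u t s n :
  (forall s, 0 <= V 0%N s) ->
  (forall n a s, rew a s + V n (step a s) <= V n.+1 s) ->
  gain step rew pi u t s n <= V n s.
Proof.
move=> V0 VS; elim: n t s => [|n IH] t s /=; first exact: V0.
by apply: le_trans (VS n (pi t s u) s); rewrite lerD2l.
Qed.

Lemma integral_unit_cst (R : realType) (c : R) :
  (\int[lebesgue_measure]_(u in `[0%R, 1%R]) c%:E = c%:E :> \bar R)%E.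
Proof.
rewrite (integral_cst lebesgue_measure)//= lebesgue_measure_itv /= lte_fin ltr01.
by rewrite -EFinB subr0 mule1.
Qed.

Definition dirac_pmf (R : realType) (S : finType) (s s' : S) : R := (s' == s)%:R.

Lemma is_pmf_dirac (R : realType) (S : finType) (s : S) :
  is_pmf (@dirac_pmf R S s).
Proof.
split=> [x|]; first exact: ler0n.
rewrite esum_finType => [|x]; last by rewrite lee_fin ler0n.
rewrite sumEFin (bigD1 s)//= big1 ?addr0 /dirac_pmf ?eqxx//.
by move=> x /negPf ->.
Qed.

Lemma sum_dirac_pmf (R : realType) (S : finType) (s : S) (f : S -> \bar R) :
  (\sum_(x : S) (dirac_pmf R s x)%:E * f x = f s)%E.
Proof.
rewrite (bigD1 s)//= big1 ?adde0 /dirac_pmf ?eqxx ?mul1e//.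
by move=> x /negPf ->; rewrite mul0e.
Qed.

Lemma value_le_bellman (R : realType) (S A : finType) (step : A -> S -> S)
    (rew : A -> S -> R) (V : nat -> S -> R) (pi : policy R S A) T (mu : S -> R) :
  (forall s, 0 <= mu s) -> (forall a s, 0 <= rew a s) ->
  (forall s, 0 <= V 0%N s) ->
  (forall n a s, rew a s + V n (step a s) <= V n.+1 s) ->
  is_policy pi ->
  (value (det_instance step rew T) pi mu
   <= \sum_(s : S) (mu s)%:E * (V T s)%:E)%E.
Proof.
move=> mu0 rew0 V0 VS mpi; rewrite value_det//; apply: lee_sum => s _.
apply: lee_wpmul2l; first by rewrite lee_fin.
rewrite -[leRHS]integral_unit_cst; apply: ge0_le_integral => //.
- by move=> u _; rewrite lee_fin gain_sum sumr_ge0.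
- by apply/measurable_EFinP; exact: measurable_gain.
- by move=> u _; rewrite lee_fin gain_le_bellman.
Qed.

Lemma value_bellman (R : realType) (S A : finType) (step : A -> S -> S)
    (rew : A -> S -> R) (V : nat -> S -> R) (pi : policy R S A) T (mu : S -> R) :
  (forall s, 0 <= mu s) -> (forall a s, 0 <= rew a s) ->
  (forall s u, gain step rew pi u 0 s T = V T s) ->
  value (det_instance step rew T) pi mu = (\sum_(s : S) (mu s)%:E * (V T s)%:E)%E.
Proof.
move=> mu0 rew0 piV; rewrite value_det//; apply: eq_bigr => s _.
congr (_ * _)%E; under eq_integral do rewrite piV.
exact: integral_unit_cst.
Qed.

(** Verification principle: the Bellman bound holds for all policies and initial laws, and [pi]
    meets it from every state. *)
Lemma optimal_bellman (R : realType) (S A : finType) (step : A -> S -> S)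
    (rew : A -> S -> R) (V : nat -> S -> R) (pi : policy R S A) T :
  (forall a s, 0 <= rew a s) -> (forall s, 0 <= V 0%N s) ->
  (forall n a s, rew a s + V n (step a s) <= V n.+1 s) ->
  is_policy pi -> (forall s u, gain step rew pi u 0 s T = V T s) ->
  optimal (det_instance step rew T) pi.
Proof.
move=> rew0 V0 VS mpi piV; split=> // mu [mu0 _] pi' mpi'.
by rewrite (value_bellman mu0 rew0 piV) value_le_bellman.
Qed.

Lemma value_optimal (R : realType) (S A : finType) (step : A -> S -> S)
    (rew : A -> S -> R) (V : nat -> S -> R) (pi pi' : policy R S A) T (s : S) :
  (forall a s, 0 <= rew a s) -> (forall s, 0 <= V 0%N s) ->
  (forall n a s, rew a s + V n (step a s) <= V n.+1 s) ->
  is_policy pi -> (forall s u, gain step rew pi u 0 s T = V T s) ->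
  optimal (det_instance step rew T) pi' ->
  value (det_instance step rew T) pi' (@dirac_pmf R S s) = (V T s)%:E.
Proof.
move=> rew0 V0 VS mpi piV [mpi' opt].
have [mu0 _] := is_pmf_dirac R s.
apply/eqP; rewrite eq_le; apply/andP; split.
  by rewrite (le_trans (value_le_bellman T mu0 rew0 V0 VS mpi'))// sum_dirac_pmf.
apply: le_trans (opt _ (is_pmf_dirac R s) _ mpi).
by rewrite (value_bellman mu0 rew0 piV) sum_dirac_pmf.
Qed.

(** The deficit [V T s - gain] is nonnegative pathwise, and by optimality at the Dirac mass its
    integral is 0, so it vanishes almost everywhere. *)
Lemma gain_optimal_ae (R : realType) (S A : finType) (step : A -> S -> S)
    (rew : A -> S -> R) (V : nat -> S -> R) (pi pi' : policy R S A) T (s : S) :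
  (forall a s, 0 <= rew a s) -> (forall s, 0 <= V 0%N s) ->
  (forall n a s, rew a s + V n (step a s) <= V n.+1 s) ->
  is_policy pi -> (forall s u, gain step rew pi u 0 s T = V T s) ->
  optimal (det_instance step rew T) pi' ->
  lebesgue_measure.-negligible
    [set u : R | u \in `[0, 1] /\ gain step rew pi' u 0 s T != V T s].
Proof.
move=> rew0 V0 VS mpi piV opt; have [mpi' _] := opt.
have := value_optimal s rew0 V0 VS mpi piV opt.
have [mu0 _] := is_pmf_dirac R s.
rewrite value_det// sum_dirac_pmf => intV.
pose f u := gain step rew pi' u 0 s T.
have f0 u : 0 <= f u by rewrite /f gain_sum sumr_ge0.
have mf : measurable_fun (`[0, 1]%classic : set R) f by exact: measurable_gain.
have fV u : f u <= V T s by exact: gain_le_bellman.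
have mg : measurable_fun (`[0, 1]%classic : set R) (fun u => (V T s - f u)%:E).
  by apply/measurable_EFinP; apply: measurable_funB => //; exact: measurable_cst.
have : (\int[lebesgue_measure]_(u in `[0%R, 1%R]) `|(V T s - f u)%:E| = 0)%E.
  have : (\int[lebesgue_measure]_(u in `[0%R, 1%R]) ((V T s - f u)%:E + (f u)%:E)
     = (V T s)%:E)%E.
    under eq_integral do rewrite -EFinD subrK.
    exact: integral_unit_cst.
  rewrite ge0_integralD//; first last.
  - by apply/measurable_EFinP.
  - by move=> u _; rewrite lee_fin.
  - by move=> u _; rewrite lee_fin subr_ge0.
  rewrite intV; under [in X in _ -> X = _]eq_integral.
    move=> u _; rewrite gee0_abs ?lee_fin ?subr_ge0//; over.
  (* An infinite integral of the deficit contradicts the finite total; a finite one cancels to 0. *)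
  case: integral => [x||]//= /eqP; rewrite -EFinD eqe => /eqP E.
  by congr (_%:E); apply: (addIr (V T s)); rewrite E add0r.
move=> /(ae_eq_integral_abs lebesgue_measure _ mg).
move=> /(_ (measurable_itv _)); apply: negligibleS => u [u01 uV] /= /(_ u01) /eqP.
by rewrite eqe subr_eq0 eq_sym (negPf uV).
Qed.

(** * The hub instance *)

Definition hub_step (d : nat) (a s : 'I_d.+1) : 'I_d.+1 :=
  if s == ord0 then a else ordS s.

Definition hub_rew (R : realType) (d : nat) (c rbar : R) (a s : 'I_d.+1) : R :=
  if s == ord0 then
    (if a == ord0 then c else if val a == 1%N then rbar else 0)
  else 0.

(* Optimal reward with [m] slots left from the hub; the other states only delay
   the arrival there. *)
Definition hub_value0 (R : realType) (c rbar : R) (m : nat) : R :=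
  if m is k.+1 then rbar + k%:R * c else 0.

(** Truncated subtraction gives the value 0 when too few slots are left to return to the hub. *)
Definition hub_value (R : realType) (d : nat) (c rbar : R) (m : nat)
    (s : 'I_d.+1) : R :=
  hub_value0 c rbar (m - (if s == ord0 then 0 else d.+1 - val s))%N.

Definition hub_policy (R : realType) (d T : nat) : policy R 'I_d.+1 'I_d.+1 :=
  fun t _ _ => if t.+1 == T then inord 1 else ord0.

Section HubValue.
Variables (R : realType) (d : nat) (c rbar : R).

Local Notation V := (@hub_value R d c rbar).
Local Notation W := (hub_value0 c rbar).
Local Notation rew := (@hub_rew R d c rbar).
Local Notation step := (@hub_step d).

(** State 1 differs from the hub; [c < rbar] makes the jump profitable in the last slot; the last
    bound, [rbar - c < d * c], makes it a loss when all [d] slots of absence are paid for. *)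
Definition hub_params := [/\ (0 < d)%N, 0 < c, c < rbar & rbar < d.+1%:R * c].

Lemma hub_rew_ge0 a s : hub_params -> 0 <= rew a s.
Proof.
move=> [_ c0 cr _]; rewrite /hub_rew; case: ifP => // _.
by case: ifP => _; [|case: ifP => _]; lra.
Qed.

Lemma hub_value_hub m : V m ord0 = W m.
Proof. by rewrite /hub_value eqxx subn0. Qed.

Lemma hub_value0_ge0 m : hub_params -> 0 <= W m.
Proof.
move=> [_ c0 cr _]; case: m => [|k] //=; rewrite addr_ge0 ?mulr_ge0 ?ler0n//; lra.
Qed.

Lemma hub_value0_le m n : hub_params -> (m <= n)%N -> W m <= W n.
Proof.
move=> P; have [_ c0 cr _] := P; case: m => [|m]; first by rewrite hub_value0_ge0.
case: n => [//|n]; rewrite ltnS /= => mn.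
by rewrite lerD2l ler_wpM2r ?ler_nat//; lra.
Qed.

(** Slots left and delay to the hub both drop by one; from state [d] the step wraps around to the
    hub. *)
Lemma hub_step_off m (a s : 'I_d.+1) : s != ord0 -> V m (step a s) = V m.+1 s.
Proof.
move=> s0; rewrite /hub_step /hub_value (negPf s0) -val_eqE /= -/(hub_value0 _ _).
congr (W _); have sd := ltn_ord s.
have [sd1|sd1] := ltnP s.+1 d.+1; first by rewrite modn_small//=; lia.
by rewrite (_ : s.+1 = d.+1) ?modnn//=; lia.
Qed.

(** Off the hub this is an equality. At the hub, staying is beaten only in the last slot, and a
    target other than 0 and 1 earns nothing and delays. *)
Lemma hub_bellman m (a s : 'I_d.+1) : hub_params ->
  rew a s + V m (step a s) <= V m.+1 s.
Proof.
move=> P; have [d0 c0 cr rd] := P.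
have [->|s0] := eqVneq s ord0; last first.
  by rewrite hub_step_off// /hub_rew (negPf s0) add0r.
rewrite hub_value_hub /hub_step /hub_rew eqxx.
have [->|a0] := eqVneq a ord0.
  by rewrite hub_value_hub; case: m => [|m] /=; rewrite -?natr1; lra.
rewrite /hub_value (negPf a0); case: eqP => [->|a1].
  (* A jump to 1 costs a delay [d]. If [k.+1 = m - d] slots remain on return, the claim is
     [rbar + k * c <= m * c], that is [rbar <= d.+1 * c]. *)
  rewrite /= lerD2l subn1 /=.
  have [md|dm] := leqP m d.
    by rewrite (eqP md)/= mulr_ge0 ?ler0n// ltW.
  rewrite -{2}(subnKC (ltnW dm)); have : (0 < m - d)%N by rewrite subn_gt0.
  case: (m - d)%N => // k _ /=; rewrite addnS -addSn natrD; lra.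
rewrite add0r (le_trans (hub_value0_le P (leq_subr _ _)))//.
by case: m => [|m] /=; rewrite -?natr1; lra.
Qed.

Lemma hub_value_ge0 m (s : 'I_d.+1) : hub_params -> 0 <= V m s.
Proof. exact: hub_value0_ge0. Qed.

(* Equality in the Bellman inequality at the hub forces to stay there, except
   in the last slot where it forces the jump to state 1. *)
Lemma hub_bellman_eq m (a : 'I_d.+1) : hub_params ->
  rew a ord0 + V m a = V m.+1 ord0 ->
  if m is 0%N then val a = 1%N else a = ord0.
Proof.
move=> P; have [d0 c0 cr rd] := P.
rewrite hub_value_hub /hub_rew eqxx; have [->|a0] := eqVneq a ord0.
  by rewrite hub_value_hub; case: m => [|m] //= E; exfalso; lra.
rewrite /hub_value (negPf a0); case: eqP => [->|a1].
  rewrite /= subn1 /= => /addrI; case: m => // m E; exfalso; move: E.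
  have [md|dm] := leqP m.+1 d.
    rewrite (eqP md)/= => /esym/eqP; rewrite mulf_eq0 pnatr_eq0 /= => /eqP; lra.
  have -> : (m.+1 - d = (m - d).+1)%N by rewrite subSn.
  have mE : m.+1%:R = d.+1%:R + (m - d)%:R :> R by rewrite -natrD addSn subnKC.
  by move=> /=; rewrite mE; lra.
rewrite add0r => E; exfalso; have := hub_value0_le P (leq_subr (d.+1 - val a) m); rewrite E.
by case: m {E} => [|m] /=; rewrite -?natr1; lra.
Qed.

Lemma hub_policy_gain T u t s n : hub_params -> (t + n = T)%N ->
  gain step rew (@hub_policy R d T) u t s n = V n s.
Proof.
move=> [d0 c0 cr _]; elim: n t s => [|n IH] t s tT /=; first by rewrite /hub_value sub0n.
rewrite IH; last by rewrite addSnnS.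
have [->|s0] := eqVneq s ord0; last first.
  by rewrite hub_step_off// /hub_rew (negPf s0) add0r.
rewrite /hub_rew /hub_step /hub_policy eqxx hub_value_hub -tT addnS eqSS.
case: n {tT IH} => [|n].
  rewrite addn0 eqxx -val_eqE /= inordK ?ltnS//=.
  by rewrite /hub_value sub0n /=; lra.
rewrite (_ : (t == _) = false); last by apply/eqP; lia.
by rewrite eqxx hub_value_hub /= -natr1; lra.
Qed.

Lemma is_policy_hub T : is_policy (@hub_policy R d T).
Proof.
move=> t s a; have [<-|pa] := eqVneq (@hub_policy R d T t s 0) a.
  rewrite (_ : [set u | _] = `[0, 1]%classic)//.
  by apply/seteqP; split=> u /= => [[]|].
rewrite (_ : [set u | _] = set0)//.
by apply/seteqP; split=> u //= [_ E]; move: pa; rewrite -E eqxx.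
Qed.

Lemma optimal_hub T : hub_params ->
  optimal (det_instance step rew T) (@hub_policy R d T).
Proof.
move=> P; apply: (optimal_bellman (V := V)).
- by move=> a s; exact: hub_rew_ge0.
- by move=> s; exact: hub_value_ge0.
- by move=> n a s; exact: hub_bellman.
- exact: is_policy_hub.
- by move=> s u; exact: hub_policy_gain.
Qed.

(** An optimal gain makes every Bellman inequality along the path tight, so the path stays at the
    hub and jumps to 1 in the last slot. *)
Lemma hub_optimal_traj (pi : policy R 'I_d.+1 'I_d.+1) u t n : hub_params ->
  gain step rew pi u t ord0 n.+1 = V n.+1 ord0 ->
  val (traj step pi u t ord0 n.+1) = 1%N.
Proof.
move=> P; elim: n t => [|n IH] t.
  by move=> E; apply: (hub_bellman_eq (m := 0) P); rewrite -E /= /hub_value sub0n.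
set a := pi t ord0 u.
have -> : traj step pi u t ord0 n.+2 = traj step pi u t.+1 a n.+1 by [].
have -> : gain step rew pi u t ord0 n.+2 =
  rew a ord0 + gain step rew pi u t.+1 a n.+1 by [].
move=> E.
(* The two bounds add up to the equality [E], so each of them is an equality. *)
have le1 : gain step rew pi u t.+1 a n.+1 <= V n.+1 a.
  by apply: gain_le_bellman => *; [exact: hub_value_ge0 | exact: hub_bellman].
have := hub_bellman n.+1 a ord0 P; rewrite /hub_step eqxx => le2.
have E2 : gain step rew pi u t.+1 a n.+1 = V n.+1 a by lra.
have : rew a ord0 + V n.+1 a = V n.+2 ord0 by lra.
move=> /(hub_bellman_eq P) a0; move: E2; rewrite /= in a0; rewrite a0.
exact: IH.
Qed.

End HubValue.

(** * Regret of temporal concatenation on the hub instance *)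

Lemma is_policy_temporal_concat (R : realType) (S A : countType)
    (YS YR : finType) (I : instance R S A YS YR) (pi1 pi2 : policy R S A) :
  is_policy pi1 -> is_policy pi2 -> is_policy (temporal_concat I pi1 pi2).
Proof.
move=> m1 m2 t s a; rewrite /temporal_concat odd_digitsE even_digitsE.
have mdig b (pi : policy R S A) t' : is_policy pi ->
    measurable [set u : R | u \in `[0, 1] /\ pi t' s (sub_digits b u) = a].
  move=> mpi; rewrite (_ : [set u | _] = `[0, 1]%classic `&` (setT `&`
    sub_digits b @^-1` [set v | v \in `[0, 1] /\ pi t' s v = a])).
    apply: measurableI => //; apply: measurable_sub_digits => //; exact: mpi.
  apply/seteqP; split=> u /=; last by case=> ? [_ [_ ?]].
  by case=> ? ?; split=> //; split=> //; split=> //; exact: sub_digits_itv.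
by case: (t < _)%N; exact: mdig.
Qed.

(** Almost surely the first half is played optimally and ends in state 1; the second half, played
    optimally from there, has only [n - d] useful slots. *)
Lemma value_temporal_concat_hub (R : realType) (d n : nat) (c rbar : R)
    (pi1 pi2 : policy R 'I_d.+1 'I_d.+1) : hub_params d c rbar -> (0 < n)%N ->
  optimal (det_instance (@hub_step d) (hub_rew c rbar) n) pi1 ->
  optimal (det_instance (@hub_step d) (hub_rew c rbar) n) pi2 ->
  let I := det_instance (@hub_step d) (hub_rew c rbar) n.*2 in
  value I (temporal_concat I pi1 pi2) (@dirac_pmf R 'I_d.+1 ord0) =
  (hub_value0 c rbar n + hub_value0 c rbar (n - d))%:E.
Proof.
move=> P n0 opt1 opt2 I; have [d0 c0 cr rd] := P.
have rew0 a s : 0 <= @hub_rew R d c rbar a s by exact: hub_rew_ge0.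
have [mu0 _] := is_pmf_dirac R (ord0 : 'I_d.+1).
rewrite value_det// sum_dirac_pmf -[RHS]integral_unit_cst.
have mTC : is_policy (temporal_concat I pi1 pi2).
  by apply: is_policy_temporal_concat; [case: opt1 | case: opt2].
(* Each half is suboptimal only on a null set of its own digits, hence of [u]. Optimality covers
   every initial law, so the start in state 1 is allowed for the second half. *)
have neg s pi b : optimal (det_instance (@hub_step d) (hub_rew c rbar) n) pi ->
   lebesgue_measure.-negligible [set u : R | u \in `[0, 1] /\
     [set v : R | v \in `[0, 1] /\ gain (@hub_step d) (hub_rew c rbar) pi v 0 s n
       != hub_value c rbar n s] (sub_digits b u)].
  move=> opt; apply: sub_digits_negligible.
  apply: (gain_optimal_ae (V := hub_value c rbar) (pi := @hub_policy R d n)) opt.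
  - exact: rew0.
  - by move=> *; exact: hub_value_ge0.
  - by move=> *; exact: hub_bellman.
  - exact: is_policy_hub.
  - by move=> *; exact: hub_policy_gain.
apply: ge0_ae_eq_integral => //.
- by apply/measurable_EFinP; exact: measurable_gain.
- by move=> u _; rewrite lee_fin gain_sum sumr_ge0.
- by move=> u _; rewrite lee_fin addr_ge0// (hub_value0_ge0 _ P).
apply: negligibleS (negligibleU (neg ord0 pi1 false opt1) (neg (inord 1) pi2 true opt2)).
move=> u /=; rewrite not_implyE => -[u01].
apply: contra_notP; rewrite not_orP -odd_digitsE -even_digitsE => -[/not_andP[//|N1] /not_andP[//|N2]].
have G1 : gain (@hub_step d) (hub_rew c rbar) pi1 (odd_digits u) 0 ord0 n
    = hub_value c rbar n (ord0 : 'I_d.+1).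
  apply: contrapT => /eqP G1; apply: N1; split=> //.
  by rewrite odd_digitsE sub_digits_itv.
have G2 : gain (@hub_step d) (hub_rew c rbar) pi2 (even_digits u) 0 (inord 1) n
    = hub_value c rbar n (inord 1 : 'I_d.+1).
  apply: contrapT => /eqP G2; apply: N2; split=> //.
  by rewrite even_digitsE sub_digits_itv.
have TC1 k x : (k < n)%N ->
    temporal_concat I pi1 pi2 (0 + k)%N x u = pi1 (0 + k)%N x (odd_digits u).
  by rewrite /temporal_concat /= doubleK add0n => ->.
have TC2 k x : (k < n)%N ->
    temporal_concat I pi1 pi2 (n + k)%N x u = pi2 (0 + k)%N x (even_digits u).
  by move=> kn; rewrite /temporal_concat /= doubleK add0n ltnNge leq_addr addKn.
congr (_%:E); rewrite -addnn gainD add0n.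
have [-> ->] := eq_traj_gain (@hub_step d) (hub_rew c rbar) ord0 TC1.
have T1 : traj (@hub_step d) pi1 (odd_digits u) 0 ord0 n = inord 1.
  apply: val_inj; rewrite [RHS]inordK ?ltnS//.
  by case: n n0 G1 {opt1 opt2 I mTC neg N1 N2 G2 TC1 TC2} => // n' _; exact: hub_optimal_traj.
have [_ ->] := eq_traj_gain (@hub_step d) (hub_rew c rbar)
  (traj (@hub_step d) pi1 (odd_digits u) 0 ord0 n) TC2.
rewrite T1 G1 G2 hub_value_hub /hub_value -val_eqE /= inordK ?ltnS//=.
by rewrite subn1.
Qed.

Lemma regret_hub (R : realType) (d n : nat) (c rbar : R)
    (pistar pi1 pi2 : policy R 'I_d.+1 'I_d.+1) :
  hub_params d c rbar -> (d < n)%N ->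
  let I := det_instance (@hub_step d) (hub_rew c rbar) n.*2 in
  optimal I pistar ->
  optimal (det_instance (@hub_step d) (hub_rew c rbar) n) pi1 ->
  optimal (det_instance (@hub_step d) (hub_rew c rbar) n) pi2 ->
  regret I pistar pi1 pi2 (@dirac_pmf R 'I_d.+1 ord0) = (d.+1%:R * c - rbar)%:E.
Proof.
move=> P dn I opt opt1 opt2.
have n0 : (0 < n)%N by exact: leq_ltn_trans dn.
rewrite /regret (value_temporal_concat_hub P n0 opt1 opt2).
rewrite (value_optimal (V := hub_value c rbar) (pi := @hub_policy R d n.*2) _ _ _ _ _ _ opt).
- rewrite hub_value_hub -EFinB; congr (_%:E).
  (* Since [d < n], the horizons [n.*2], [n] and [n - d] are all positive, so each optimal value has
     the form [rbar + k * c]. *)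
  have -> : (n = (d + (n - d).-1).+1)%N by lia.
  set k := (n - d).-1.
  rewrite doubleS -addnn /=.
  have -> : ((d + k).+1 - d = k.+1)%N by lia.
  by rewrite /= -!natr1 !natrD; lra.
- by move=> *; exact: hub_rew_ge0.
- by move=> *; exact: hub_value_ge0.
- by move=> *; exact: hub_bellman.
- exact: is_policy_hub.
- by move=> *; exact: hub_policy_gain.
Qed.

(** * The 0-diameter of the hub instance *)

(** Quantile map: [[0, 1[] is cut into consecutive half-open cells of lengths [nu 0], ..., [nu d],
    with ends the partial sums [C]. *)
Lemma finite_pmf_quantile (R : realType) (d : nat) (nu : 'I_d.+1 -> R) :
  is_pmf nu -> exists g : R -> 'I_d.+1, forall a,
    measurable [set u : R | u \in `[0, 1] /\ g u = a] /\
    lebesgue_measure [set u : R | u \in `[0%R, 1%R] /\ g u = a] = (nu a)%:E.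
Proof.
move=> [nu0]; rewrite esum_finType => [|x]; last by rewrite lee_fin.
rewrite sumEFin => -[nu1].
pose C k := \sum_(0 <= i < k) nu (inord i).
have CS k : C k.+1 = C k + nu (inord k) by rewrite /C big_nat_recr.
have C0 : C 0%N = 0 by rewrite /C big_geq.
have C1 : C d.+1 = 1.
  by rewrite /C big_mkord -nu1; apply: eq_bigr => i _; rewrite inord_val.
have Cle k l : (k <= l)%N -> C k <= C l.
  move=> /subnK <-; elim: (l - k)%N => [//|m IH].
  by rewrite addSn CS (le_trans IH)// lerDl.
pose g (u : R) : 'I_d.+1 := odflt ord0 [pick j : 'I_d.+1 | C j <= u < C j.+1].
have gE u (a : 'I_d.+1) : C a <= u < C a.+1 -> g u = a.
  move=> /andP[au ua]; rewrite /g; case: pickP => [j /andP[ju uj]|/(_ a)] /=.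
    have [ja|aj|/val_inj//] := ltngtP j a.
      by exfalso; have := Cle _ _ ja; lra.
    by exfalso; have := Cle _ _ aj; lra.
  by rewrite au ua.
have gI u : 0 <= u < 1 -> C (g u) <= u < C (g u).+1.
  (* The least [k] with [u < C k] marks the right end of the cell of [u]; it is positive because
     [C 0 = 0 <= u]. *)
  move=> /andP[u0 u1]; have ex : exists k, u < C k by exists d.+1; rewrite C1.
  case: (ex_minnP ex) => [[|k]]; first by rewrite C0 ltNge u0.
  move=> uk kmin; have kd : (k < d.+1)%N by apply: kmin; rewrite C1.
  have ku : C k <= u.
    by rewrite leNgt; apply/negP => /kmin; rewrite ltnn.
  by rewrite (gE u (Ordinal kd)) /= ?ku ?uk.
exists g => a.
have Ca0 : 0 <= C a by rewrite -C0 Cle.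
have Ca1 : C a.+1 <= 1 by rewrite -C1 Cle.
(* The point 1 lies in no cell and gets the default value of [g]; it adds a null set to one
   fiber. *)
pose B : set R := if g 1 == a then [set 1] else set0.
have mB : measurable B by rewrite /B; case: ifP.
have B0 : lebesgue_measure B = 0%E.
  by rewrite /B; case: ifP => _; [exact: lebesgue_measure_set1 | exact: measure0].
have -> : [set u : R | u \in `[0, 1] /\ g u = a] = `[C a, C a.+1[%classic `|` B.
  apply/seteqP; split=> u /=; rewrite !in_itv /=.
    move=> [/andP[u0 u1] gu]; have [uE|un1] := eqVneq u 1.
      by right; rewrite /B -gu uE eqxx.
    by left; rewrite -gu gI// u0 lt_neqAle un1.
  case=> [aua|].
    have := gE _ _ aua; case/andP: aua => au ua ->; split=> //.
    by rewrite (le_trans Ca0 au) ltW// (lt_le_trans ua).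
  by rewrite /B; case: eqP => // <- ->; rewrite ler01 lexx.
split; first exact: measurableU.
transitivity (lebesgue_measure (`[C a, C a.+1[%classic : set R)).
  by apply: measureU0.
rewrite lebesgue_measure_itv /= lte_fin CS inord_val.
case: ltP => [_|]; first by rewrite -EFinB addrC addKr.
by rewrite gerDl => na; congr (_%:E); apply/eqP; rewrite eq_le na nu0.
Qed.

(** Controls have no effect before the hub; the bound includes the moment of return, where the
    remainder is 0. *)
Lemma hub_traj_off (R : realType) (d : nat) (pi : policy R 'I_d.+1 'I_d.+1)
    (u : R) t (s : 'I_d.+1) k : s != ord0 -> (s + k <= d.+1)%N ->
  val (traj (@hub_step d) pi u t s k) = ((s + k) %% d.+1)%N.
Proof.
elim: k t s => [|k IH] t s s0; first by rewrite addn0 modn_small.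
rewrite addnS /= {2}/hub_step (negPf s0) => sk.
have [sd|sd] := ltnP s.+1 d.+1; last first.
  have -> : k = 0%N by have := ltn_ord s; lia.
  by rewrite /= addn0.
have oS : (ordS s : nat) = s.+1 by rewrite /= modn_small.
by rewrite IH -?val_eqE ?oS//= ?modn_small//; lia.
Qed.

Lemma hub_traj_home (R : realType) (d : nat) (pi : policy R 'I_d.+1 'I_d.+1)
    (u : R) t (s : 'I_d.+1) k :
  (forall j x, (j < k)%N -> pi (t + j)%N x u = ord0) ->
  (s == ord0) || (d.+1 <= s + k)%N ->
  traj (@hub_step d) pi u t s k = ord0.
Proof.
elim: k t s => [|k IH] t s piE /=.
  by rewrite addn0 leqNgt ltn_ord orbF => /eqP.
move=> sk; apply: IH => [j x jk|]; first by rewrite addSnnS piE.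
rewrite /hub_step; case: eqP sk => [_ _|/eqP s0 /= sk].
  by rewrite -(addn0 t) piE.
have [sd|sd] := ltnP s.+1 d.+1.
  by apply/orP; right; rewrite /= modn_small//; lia.
by rewrite -val_eqE /= (_ : s.+1 = d.+1) ?modnn//; have := ltn_ord s; lia.
Qed.

Lemma diameter_hub (R : realType) (d T : nat) (rew : 'I_d.+1 -> 'I_d.+1 -> R) :
  (0 < d)%N -> (d.+1 < T)%N ->
  diameter0 (det_instance (@hub_step d) rew T) = d.+1%:R.
Proof.
move=> d0 dT; rewrite /diameter0; set D := [set t : nat | _].
have Dd : D d.+1.
  move=> nu nu' [nu0 +] pnu' t0 /= t0T; have [nu'0 _] := pnu'.
  rewrite esum_finType => [|x]; last by rewrite lee_fin.
  move=> nu1; split=> //.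
  have [g gP] := finite_pmf_quantile pnu'.
  (* Under action 0 every state is at the hub after [d] slots; slot [t0 + d] then jumps to a target
     of law [nu'] drawn by the quantile map. *)
  exists (fun t _ u => if t == (t0 + d)%N then g u else ord0); split.
    move=> t s a; case: eqP => _; first by case: (gP a).
    have [->|na] := eqVneq a ord0.
      by rewrite (_ : [set u | _] = `[0, 1]%classic)//; apply/seteqP; split=> u //= -[].
    by rewrite (_ : [set u | _] = set0)//; apply/seteqP; split=> u //= -[_ /esym/eqP]; rewrite (negPf na).
  move=> s'; rewrite state_law_det//; last by lia.
  have [mg <-] := gP s'.
  rewrite -[RHS]mul1e -nu1 ge0_sume_distrl; last by move=> s _; rewrite lee_fin.
  apply: eq_bigr => s _; congr (_ * _)%E.
  transitivity (\int[lebesgue_measure]_(u in `[0%R, 1%R])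
      (\1_[set u : R | u \in `[0%R, 1%R] /\ g u = s'] u)%:E)%E.
    apply: eq_integral => u; rewrite inE => u01; congr (_%:E).
    rewrite -[X in traj _ _ _ _ _ X]addn1 trajD (hub_traj_home (t := t0) (k := d)); last 2 first.
    - by move=> j x jd; rewrite /= eqn_add2l ltn_eqF.
    - by case: eqVneq => //= s0; move: s0; rewrite -val_eqE /=; lia.
    rewrite /= {1}/hub_step !eqxx indicE; congr (_%:R); congr nat_of_bool.
    by apply/eqP/idP => [<-|]; rewrite inE //=; case.
  rewrite integral_indic//; congr (lebesgue_measure _).
  by apply/setIidPl => u [].
have Dlow t : D t -> (d < t)%N.
  move=> Dt; rewrite ltnNge; apply/negP => td.
  have T0 : (0 < T - t)%N by lia.
  (* From state 1, after [t <= d] slots, the state is surely [t + 1] modulo [d.+1], so the target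
     [t] has probability 0. *)
  have [_ [pi [mpi]]] := Dt _ _ (is_pmf_dirac R (inord 1 : 'I_d.+1))
    (is_pmf_dirac R (inord t : 'I_d.+1)) 0%N T0.
  have [mu0 _] := is_pmf_dirac R (inord 1 : 'I_d.+1).
  move=> /(_ (inord t)); rewrite state_law_det//; last by lia.
  rewrite sum_dirac_pmf /dirac_pmf eqxx.
  under eq_integral => u _.
    rewrite (_ : (_ == _) = false); first over.
    rewrite -val_eqE hub_traj_off ?inordK ?ltnS// -?val_eqE /= ?inordK ?ltnS//.
    have [td1|td1] := ltnP t d; first by rewrite modn_small; lia.
    by rewrite (_ : (1 + t = d.+1)%N) ?modnn; lia.
  by rewrite integral0 => -[] /eqP; rewrite eq_sym oner_eq0.
apply/eqP; rewrite eq_le; apply/andP; split.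
  apply: ge_inf; last by exists d.+1.
  by exists d.+1%:R => _ [t Dt <-]; rewrite ler_nat Dlow.
apply: lb_le_inf; first by exists d.+1%:R, d.+1.
by move=> _ [t Dt <-]; rewrite ler_nat Dlow.
Qed.

(** * Choice of the parameters and conclusion *)

Theorem theorem2 (R : realType) (rbar sigma : R) (d0 : nat)
    (hrbar : 0 <= rbar) (hsigma0 : 0 < sigma) (hsigma : sigma < rbar / 2)
    (hd0 : (5 <= d0)%N) :
  exists (S A : countType) (YS YR : finType) (q : YR -> R)
         (p : nat -> A -> S -> YS -> S) (r : nat -> A -> S -> YR -> R)
         (mu0 : S -> R),
    [/\ (0 < #|YS|)%N, is_pmf q, is_pmf mu0, max_reward r rbar &
     forall T : nat, ~~ odd T -> (2 * d0 + 2 < T)%N ->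
       let I0 := Instance T p r q in
       [/\ diameter0 I0 = d0%:R,
           exists pistar, optimal I0 pistar,
           exists pi1, optimal (first_half I0) pi1,
           exists pi2, optimal (second_half I0) pi2 &
           forall pistar pi1 pi2, optimal I0 pistar ->
             optimal (first_half I0) pi1 -> optimal (second_half I0) pi2 ->
             regret I0 pistar pi1 pi2 mu0
             = ((diameter0 I0 - 2) * rbar - sigma)%:E]].
Proof.
case: d0 hd0 => // d hd.
pose c : R := (d%:R * rbar - sigma) / d.+1%:R.
have dc : d.+1%:R * c = d%:R * rbar - sigma by rewrite mulrC divfK.
have d4 : 4 <= d%:R :> R by rewrite (ler_nat R 4).
(* With [d >= 4] and [sigma < rbar / 2], the number [d * rbar - sigma] lies strictly between [rbar]
   and [d.+1 * rbar]. *)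
have P : hub_params d c rbar.
  have dr : 4 * rbar <= d%:R * rbar by rewrite ler_wpM2r.
  have pd : 0 < d.+1%:R :> R by rewrite ltr0n.
  split; first by lia.
  - by rewrite /c divr_gt0//; lra.
  - by rewrite /c ltr_pdivrMr// -natr1; lra.
  - by rewrite dc; lra.
exists 'I_d.+1, 'I_d.+1, unit, unit, (fun _ => 1),
  (fun _ a s _ => hub_step a s), (fun _ a s _ => hub_rew c rbar a s),
  (@dirac_pmf R 'I_d.+1 ord0).
split.
- by rewrite card_unit.
- split=> [_|]; first exact: ler01.
  by rewrite esum_finType => [|_]; rewrite ?lee_fin ?ler01// big_const card_unit /= adde0.
- exact: is_pmf_dirac.
- have [d_gt0 c0 cr _] := P; split.
    move=> _ a s _; rewrite hub_rew_ge0//= /hub_rew.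
    by do ![case: ifP => _]; lra.
  by exists 0%N, (inord 1), ord0, tt; rewrite /hub_rew eqxx -val_eqE /= inordK.
move=> T Todd hT I0.
have [n Tn] : exists n, T = n.*2 by exists T./2; rewrite even_halfK.
have dn : (d < n)%N by lia.
have I0E : I0 = det_instance (@hub_step d) (hub_rew c rbar) n.*2 by rewrite /I0 Tn.
have hE : first_half I0 = det_instance (@hub_step d) (hub_rew c rbar) n.
  by rewrite I0E /first_half /= doubleK.
(* By stationarity the second half is the same instance as the first. *)
have hE2 : second_half I0 = det_instance (@hub_step d) (hub_rew c rbar) n.
  by rewrite I0E /second_half /= doubleK.
have dE : diameter0 I0 = d.+1%:R.
  rewrite I0E diameter_hub//; lia.
split.
- exact: dE.
- by rewrite I0E; exists (@hub_policy R d n.*2); exact: optimal_hub.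
- by rewrite hE; exists (@hub_policy R d n); exact: optimal_hub.
- by rewrite hE2; exists (@hub_policy R d n); exact: optimal_hub.
- move=> pistar pi1 pi2; rewrite hE hE2 dE I0E => o o1 o2.
  by rewrite regret_hub// dc -natr1; congr (_%:E); lra.
Qed.
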